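(* Let $(X,\sigma,\tau)$ be a non-degenerate solution, and let $U,T\colon X\to X$ be given by $U(x)=\sigma_x^{-1}(x)$ and $T(x)=\tau_x^{-1}(x)$. Then $U$ and $T$ commute, i.e. $UT=TU$.
   Context: A (set-theoretic) solution (of the Yang-Baxter equation) $(X,\sigma,\tau)$ is a set $X$ (of arbitrary cardinality) with maps $\sigma,\tau\colon X^2\to X$ such that, writing $\sigma_x(y)=\sigma(x,y)$ and $\tau_y(x)=\tau(x,y)$, the map $r\colon X^2\to X^2$, $r(x,y)=(\sigma_x(y),\tau_y(x))$ satisfies the braid relation $(\mathrm{id}\times r)(r\times \mathrm{id})(\mathrm{id}\times r)=(r\times \mathrm{id})(\mathrm{id}\times r)(r\times \mathrm{id})$ on $X^3$. It is non-degenerate if all $\sigma_x$ and all $\tau_y$ ($x,y\in X$) are bijections of $X$. *)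

(* Defs.v *)
From mathcomp Require Import all_boot.
From mathcomp Require Import boolp classical_sets functions.

Set Implicit Arguments.
Unset Strict Implicit.
Unset Printing Implicit Defensive.

Definition sigma_at (X : Type) (sigma : X * X -> X) (x y : X) : X :=
  sigma (x, y).

(* The subscript of tau is its second argument: tau_y(x) = tau(x, y). *)
Definition tau_at (X : Type) (tau : X * X -> X) (y x : X) : X := tau (x, y).

Definition rmap (X : Type) (sigma tau : X * X -> X) (p : X * X) : X * X :=
  let: (x, y) := p in (sigma_at sigma x y, tau_at tau y x).

Definition r_x_id (X : Type) (r : X * X -> X * X) (p : X * X * X) :
    X * X * X :=
  let: (x, y, z) := p in let: (x', y') := r (x, y) in (x', y', z).

Definition id_x_r (X : Type) (r : X * X -> X * X) (p : X * X * X) :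
    X * X * X :=
  let: (x, y, z) := p in let: (y', z') := r (y, z) in (x, y', z').

Definition is_solution (X : Type) (sigma tau : X * X -> X) : Prop :=
  let r := rmap sigma tau in
  id_x_r r \o r_x_id r \o id_x_r r =1 r_x_id r \o id_x_r r \o r_x_id r.

Definition non_degenerate (X : Type) (sigma tau : X * X -> X) : Prop :=
  (forall x, bijective (sigma_at sigma x)) /\
  (forall y, bijective (tau_at tau y)).

Definition bij_inv (A B : Type) (f : A -> B) (fbij : bijective f) : B -> A :=
  ((bijection_of_bijective fbij)^-1)%FUN.

Lemma bij_invK (A B : Type) (f : A -> B) (fbij : bijective f) :
  cancel f (bij_inv fbij).
Proof.
by move=> x; apply: (@funK _ _ _ (bijection_of_bijective fbij)); rewrite inE.
Qed.

Lemma bij_invKV (A B : Type) (f : A -> B) (fbij : bijective f) :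
  cancel (bij_inv fbij) f.
Proof.
have [g _ gK] := fbij; move=> y.
by rewrite -[y]gK bij_invK.
Qed.

Definition Umap (X : Type) (sigma tau : X * X -> X)
    (nd : non_degenerate sigma tau) (x : X) : X :=
  bij_inv (proj1 nd x) x.

Definition Tmap (X : Type) (sigma tau : X * X -> X)
    (nd : non_degenerate sigma tau) (x : X) : X :=
  bij_inv (proj2 nd x) x.

(* Main.v *)
(* Write x ~ y when sigma_x = sigma_y and tau_x = tau_y.  The braid relation
   applied to (x, Ux) and to (Tx, x) yields tau_{Ux}(x) ~ Ux and
   tau_{sigma_{Tx}(x)} = tau_{Tx}.  The first fact shows that
   x |-> tau_{Ux}(x) is a section of T.  The value T(sigma_p(x)) depends on p
   and Tx only; with p = Tx and the second fact this makes T injective.  So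
   every y equals tau_{UTy}(Ty), whence sigma_y = sigma_{UTy}.  The mixed
   component of the braid relation on (Tx, UTx, Ux) then reads
   tau_{Ux}(UTx) = Ux, that is, TUx = UTx. *)
Require Import Defs.
From mathcomp Require Import all_boot.

Section Diagonals.

Variables (X : Type) (sigma tau : X * X -> X).
Hypothesis sol : is_solution sigma tau.
Hypothesis nd : non_degenerate sigma tau.

Local Notation s := (sigma_at sigma).
Local Notation t := (tau_at tau).
Local Notation U := (Umap nd).
Local Notation T := (Tmap nd).

Lemma braid_sigma x y z : s x (s y z) = s (s x y) (s (t y x) z).
Proof. by case: (sol (x, y, z)). Qed.

Lemma braid_mixed x y z :
  t (s (t y x) z) (s x y) = s (t (s y z) x) (t z y).
Proof. by case: (sol (x, y, z)). Qed.

Lemma braid_tau x y z : t z (t y x) = t (t z y) (t (s y z) x).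
Proof. by case: (sol (x, y, z)). Qed.

Lemma sigma_inj x : injective (s x).
Proof. exact: bij_inj (proj1 nd x). Qed.

Lemma tau_inj y : injective (t y).
Proof. exact: bij_inj (proj2 nd y). Qed.

Lemma sigma_Umap x : s x (U x) = x.
Proof. exact: bij_invKV. Qed.

Lemma tau_Tmap x : t x (T x) = x.
Proof. exact: bij_invKV. Qed.

Lemma Tmap_unique x y : t x y = x -> T x = y.
Proof. by move=> txy; apply: (@tau_inj x); rewrite tau_Tmap. Qed.

Lemma sigma_tau_Umap x : s (t (U x) x) =1 s (U x).
Proof.
by move=> z; apply: (@sigma_inj x); rewrite [RHS]braid_sigma sigma_Umap.
Qed.

Lemma tau_tau_Umap x : t (t (U x) x) =1 t (U x).
Proof.
(* The braid relation on [(w, x, U x)] compares the two maps only at points [t x w]; surjectivity of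
   [t x] reaches every [z]. *)
have [g _ gK] := proj2 nd x.
by move=> z; rewrite -[z]gK [RHS]braid_tau sigma_Umap.
Qed.

Lemma tau_sigma_Tmap x : t (s (T x) x) =1 t (T x).
Proof. by move=> z; apply: (@tau_inj x); rewrite [RHS]braid_tau tau_Tmap. Qed.

Lemma Tmap_tau_Umap x : T (t (U x) x) = x.
Proof. by apply: Tmap_unique; rewrite tau_tau_Umap. Qed.

Lemma Tmap_sigma x q : T (s (t (T x) q) x) = s q (T x).
Proof.
by apply: Tmap_unique; rewrite braid_mixed tau_Tmap tau_sigma_Tmap.
Qed.

Lemma Tmap_inj : injective T.
Proof.
move=> x y Txy; apply: (@sigma_inj (T x)).
have eqT : T (s (T x) x) = T (s (T x) y).
  (* [q = g (T x)] solves [t (T x) q = T x], so both sides equal [s q (T x)]. *)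
  have [g _ gK] := proj2 nd (T x).
  have := Tmap_sigma y (g (T x)); rewrite -Txy gK => ->.
  by have := Tmap_sigma x (g (T x)); rewrite gK.
(* Both points are the image of their common [T]-value under the same map [t (T x)]. *)
rewrite -[LHS]tau_Tmap -[RHS]tau_Tmap -eqT tau_sigma_Tmap.
by rewrite {3}Txy tau_sigma_Tmap Txy.
Qed.

Lemma sigma_Umap_Tmap x : s (U (T x)) =1 s x.
Proof.
move=> z; rewrite -sigma_tau_Umap.
by congr (s _ z); apply: Tmap_inj; rewrite Tmap_tau_Umap.
Qed.

Lemma tau_Umap_Tmap x : t (U x) (U (T x)) = U x.
Proof.
apply: (@sigma_inj x); rewrite sigma_Umap.
(* The left side reduces to [t x (T x) = x], the right side to [s x (t (U x) (U (T x)))]. *)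
have := braid_mixed (T x) (U (T x)) (U x).
by rewrite sigma_tau_Umap sigma_Umap_Tmap !sigma_Umap tau_Tmap => <-.
Qed.

End Diagonals.

Theorem theorem3p7 (X : Type) (sigma tau : X * X -> X)
    (sol : is_solution sigma tau) (nd : non_degenerate sigma tau) :
  Umap nd \o Tmap nd =1 Tmap nd \o Umap nd.
Proof.
by move=> x /=; apply/esym/Tmap_unique/tau_Umap_Tmap.
Qed.
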